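(* Let $F$ be a smooth function such that $xF(\ln x)$ is concave in the unit interval $x\in[0,1]$, and let $E_x(\cdot\|\cdot)$ be the associated relative quantifier. Let $(\rho,\sigma)$ and $(\rho',\sigma')$ be two pairs of commuting states of a finite-dimensional quantum system, that is $[\rho,\sigma]=[\rho',\sigma']=0$, with $\sigma,\sigma'$ both full rank. If $(\rho,\sigma)\succ(\rho',\sigma')$, namely $\rho\succ\rho'$ and $\sigma\succ\sigma'$, then $$E_{s_{\min}}(\rho'\|\sigma')\ \ge\ E_{s_{\min}}(\rho\|\sigma),$$ where $s_{\min}$ denotes the smallest eigenvalue of $\sigma$.
   Context: For two pairs of states, $(\rho,\sigma)\succ(\rho',\sigma')$ is the partial order defined by the existence of a quantum channel (completely positive trace-preserving map) $\mathcal E$ on the set of states of the system with $\mathcal E(\rho)=\rho'$ and $\mathcal E(\sigma)=\sigma'$. For two single states, $\rho\succ\rho'$ ($\rho$ majorizes $\rho'$) means that, with the eigenvalues of each arranged in non-increasing order, every partial sum of the $m$ largest eigenvalues of $\rho$ is at least the corresponding partial sum for $\rho'$. Given $F$, put $E(\rho)=\mathrm{Tr}[\rho F(\ln\rho)]$. For commuting full rank density matrices $\rho,\sigma$ and a real number $x$ the relative quantifier is $$E_x(\rho\|\sigma)=\mathrm{Tr}\big[\rho\,F(\ln(x\rho\sigma^{-1}))\big]=\mathrm{Tr}\big[\rho\,F(\ln\rho-\ln\sigma+\ln x)\big].$$ In a common eigenbasis, with $\rho=\sum_i r_i|i\rangle\langle i|$ and $\sigma=\sum_i s_i|i\rangle\langle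 i|$, this is $E_x(\rho\|\sigma)=\sum_i r_i F\big(\ln(x\,r_i/s_i)\big)$. *)

(* Defs.v *)
From HB Require Import structures.
From mathcomp Require Import all_boot all_order all_algebra.
From mathcomp Require Import complex.
From mathcomp Require Import all_classical all_reals all_analysis.
Set Implicit Arguments.
Unset Strict Implicit.
Unset Printing Implicit Defensive.
Import Order.TTheory GRing.Theory Num.Theory.
Import numFieldNormedType.Exports.

Local Open Scope classical_set_scope.
Local Open Scope ring_scope.
Local Open Scope sesquilinear_scope.
Local Open Scope complex_scope.

Section Quantum.
Variable R : realType.
Local Notation C := R[i].

Definition psd (n : nat) (A : 'M[C]_n) : Prop :=
  A \is hermsymmx /\ forall v : 'rV[C]_n, 0 <= (v *m A *m v ^t*) 0 0.

Definition density (n : nat) (rho : 'M[C]_n) : Prop :=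
  psd rho /\ \tr rho = 1.

(* A matrix of size \sum_(i < k) n is read as a k x k array of n x n blocks,
   that is, as an operator on C^k (x) C^n. *)
Definition ampliation (n k : nat) (E : 'M[C]_n -> 'M[C]_n)
    (A : 'M[C]_(\sum_(i < k) n)) : 'M[C]_(\sum_(i < k) n) :=
  \mxblock_(i < k, j < k) E (submxblock A i j).

Definition completely_positive (n : nat) (E : 'M[C]_n -> 'M[C]_n) : Prop :=
  forall (k : nat) (A : 'M[C]_(\sum_(i < k) n)),
    psd A -> psd (ampliation E A).

Definition trace_preserving (n : nat) (E : 'M[C]_n -> 'M[C]_n) : Prop :=
  forall A : 'M[C]_n, \tr (E A) = \tr A.

Definition quantum_channel (n : nat) (E : {linear 'M[C]_n -> 'M[C]_n}) : Prop :=
  completely_positive E /\ trace_preserving E.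

(* (rho, sigma) > (rho', sigma'): one and the same channel maps rho to rho' and
   sigma to sigma'.  This is not the conjunction of the two separate
   majorization relations between single states. *)
Definition pair_majorizes (n : nat) (rho sigma rho' sigma' : 'M[C]_n) : Prop :=
  exists E : {linear 'M[C]_n -> 'M[C]_n},
    [/\ quantum_channel E, E rho = rho' & E sigma = sigma'].

(* Functional calculus: f is applied to the eigenvalues of A in an orthonormal
   eigenbasis.  Only meaningful for Hermitian A, whose eigenvalues are real. *)
Definition hermfun (f : R -> R) (n : nat) (A : 'M[C]_n) : 'M[C]_n :=
  invmx (spectralmx A)
    *m diag_mx (map_mx (fun z : C => (f (complex.Re z))%:C) (spectral_diag A))
    *m spectralmx A.

(* E_x(rho || sigma) = Tr[rho F(ln(x rho sigma^-1))], a real number seen in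
   R[i] (so <= below is the order of the reals).  When rho is not full rank,
   the value of ln at 0 is irrelevant: the kernel of rho sigma^-1 is the kernel
   of rho and contributes 0, i.e. 0 F(ln 0) is read as 0. *)
Definition relative_quantifier (F : R -> R) (x : R) (n : nat)
    (rho sigma : 'M[C]_n) : C :=
  \tr (rho *m hermfun F (hermfun (@ln R) (x%:C *: (rho *m invmx sigma)))).

Definition smallest_eigenvalue (n : nat) (A : 'M[C]_n) (s : R) : Prop :=
  eigenvalue A s%:C /\ forall a : C, eigenvalue A a -> s%:C <= a.

Definition smooth (F : R -> R) : Prop :=
  forall (k : nat) (x : R), derivable (derive1n k F) x 1.

Definition concave_on (D : set R) (g : R -> R) : Prop :=
  convex_function (D : set R^o) (fun x => - g x).

End Quantum.

(* Main.v *)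
Require Import Defs.
From HB Require Import structures.
From mathcomp Require Import all_boot all_order all_algebra.
From mathcomp Require Import complex.
From mathcomp Require Import all_classical all_reals all_analysis.
From mathcomp Require Import ring lra.
Set Implicit Arguments.
Unset Strict Implicit.
Unset Printing Implicit Defensive.
Import Order.TTheory GRing.Theory Num.Theory.
Import numFieldNormedType.Exports.
Local Open Scope classical_set_scope.
Local Open Scope ring_scope.
Local Open Scope sesquilinear_scope.
Local Open Scope complex_scope.

(* In common eigenbases, E rho = rho' and E sigma = sigma' become r' = T r and
   s' = T s for the column-stochastic matrix T j i = <j'|E(|i><i|)|j'>.  With
   g x = x F(ln x) and m = smin,
     E_m(rho || sigma) = m^-1 \sum_i s_i g(m r_i / s_i),
   where m r_i / s_i lies in [0, 1] because m <= s_i and r_i <= 1, and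
   r'_j / s'_j is the average of the r_i / s_i with weights T j i s_i / s'_j.
   Jensen's inequality for g at each j, summed over j, gives the claim. *)

(** * Weighted Jensen inequality and its classical consequence for stochastic matrices *)

(** Induction on the list. Membership of the mean in [D] is proved along with the inequality because
    two-point concavity at the next step is applied to that mean. Single weights may vanish, so zero
    head and zero tail are treated apart. *)
Lemma concave_jensen (R : realType) (D : set R^o) (g : R -> R) (I : Type)
    (s : seq I) (w x : I -> R) :
  convex_set D -> concave_on D g ->
  (forall i, 0 <= w i) -> (forall i, x i \in D) -> 0 < \sum_(i <- s) w i ->
  let W := \sum_(i <- s) w i in let m := (\sum_(i <- s) w i * x i) / W in
  m \in D /\ \sum_(i <- s) w i * g (x i) <= W * g m.
Proof.
move=> cD cg w0 xD; elim: s => [|i s IHs] /=; first by rewrite big_nil ltxx.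
rewrite !big_cons; set W := \sum_(j <- s) w j; set M := \sum_(j <- s) w j * x j.
have := w0 i; rewrite le_eqVlt => /predU1P[<-|wi0].
  by rewrite !mul0r !add0r => /IHs.
have : 0 <= W by exact: sumr_ge0.
rewrite le_eqVlt => /predU1P[/esym W0 _|W_gt0 _].
  (* A zero total of nonnegative weights forces each of them to be zero. Since [I] is a bare type,
     the weights are reached by position in the list. *)
  have ws j : (j < size s)%N -> forall d, w (nth d s j) = 0.
    move=> js d; apply/eqP; rewrite eq_le w0 andbT -W0 /W (big_nth d).
    rewrite big_mkord (bigD1 (Ordinal js)) //= lerDl.
    by apply: sumr_ge0 => k _; exact: w0.
  have z (h : I -> R) : \sum_(j <- s) w j * h j = 0.
    rewrite (big_nth i) big_nat big1// => j /andP[_ js].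
    by rewrite ws// mul0r.
  by rewrite /M !z W0 !addr0 mulrAC mulfV ?mul1r ?gt_eqF//; split.
have [mD gW] := IHs W_gt0.
have wW : 0 < w i + W by rewrite addr_gt0.
(* With this ratio the new mean is the convex combination of [x i] and the mean [M / W] of the
   tail. *)
pose t := w i / (w i + W).
have t0 : 0 <= t by rewrite divr_ge0// ltW.
have t1 : t <= 1 by rewrite ler_pdivrMr// mul1r lerDl ltW.
have tE : 1 - t = W / (w i + W) by rewrite /t; field; rewrite gt_eqF.
pose p : {i01 R} := Itv01 t0 t1.
have mE : (w i * x i + M) / (w i + W) = t * x i + (1 - t) * (M / W).
  by rewrite tE /t; field; rewrite !gt_eqF.
split; first by rewrite mE; exact: (cD _ _ p (xD i) mD).
have : - g (t * x i + (1 - t) * (M / W)) <= t * - g (x i) + (1 - t) * - g (M / W).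
  exact: (cg p _ _ (xD i) mD).
rewrite -mE tE /t => gle.
have : (w i + W) * (w i / (w i + W) * - g (x i) + W / (w i + W) * - g (M / W))
  = - (w i * g (x i) + W * g (M / W)) by field; rewrite gt_eqF.
move: gle; rewrite -(ler_pM2l wW) => /[swap] ->.
rewrite mulrN lerN2; apply: le_trans; exact: lerD.
Qed.

Lemma convex_set_unit (R : realType) : convex_set (`[0, 1]%classic : set R^o).
Proof.
move=> x y p; rewrite !inE /= !in_itv/= => /andP[x0 x1] /andP[y0 y1].
have p0 : 0 <= p%:num by [].
have p1 : p%:num <= 1 by [].
change (0 <= p%:num * x + (1 - p%:num) * y <= 1); apply/andP; split; nra.
Qed.

Lemma stochastic_relative_quantifier (R : realType) (F : R -> R) (n : nat)
    (T : 'I_n -> 'I_n -> R) (r s r' s' : 'I_n -> R) (m : R) :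
  concave_on `[0, 1] (fun x : R => x * F (ln x)) ->
  (forall j i, 0 <= T j i) -> (forall i, \sum_j T j i = 1) ->
  (forall j, r' j = \sum_i T j i * r i) ->
  (forall j, s' j = \sum_i T j i * s i) ->
  (forall j, 0 < s' j) -> (forall i, 0 <= r i <= 1) ->
  0 < m -> (forall i, m <= s i) ->
  \sum_i r i * F (ln (m * (r i / s i))) <=
  \sum_j r' j * F (ln (m * (r' j / s' j))).
Proof.
move=> Fc T0 T1 r'E s'E s'0 r01 m0 ms.
have s0 i : 0 < s i by exact: lt_le_trans (ms i).
pose g (x : R) := x * F (ln x).
have gE (a b : R) : 0 < b -> a * F (ln (m * (a / b))) = m^-1 * (b * g (m * (a / b))).
  by move=> b0; rewrite /g; field; rewrite !gt_eqF.
under eq_bigr do rewrite gE//; under [leRHS]eq_bigr do rewrite gE//.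
rewrite -!mulr_sumr ler_pM2l ?invr_gt0//.
(* Each column of [T] sums to 1, so [s i] splits into the shares [T j i * s i]; at fixed [j] these
   shares add up to [s' j]. *)
have -> : \sum_i s i * g (m * (r i / s i)) =
    \sum_j \sum_i T j i * s i * g (m * (r i / s i)).
  rewrite exchange_big; apply: eq_bigr => i _.
  by rewrite -!mulr_suml T1 mul1r.
apply: ler_sum => j _.
have x01 i : m * (r i / s i) \in (`[0, 1]%classic : set R).
  have /andP[ri0 ri1] := r01 i.
  rewrite inE /= in_itv/= mulr_ge0 ?divr_ge0 ?(ltW m0) ?(ltW (s0 i))//=.
  rewrite mulrA ler_pdivrMr// mul1r.
  apply: le_trans (ms i).
  by rewrite ger_pMr.
have w0 i : 0 <= T j i * s i by rewrite mulr_ge0// ltW.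
have := s'0 j; rewrite s'E => W0.
have [_] := concave_jensen (@convex_set_unit R) Fc w0 x01 W0.
rewrite -s'E; congr (_ <= _ * g _).
rewrite r'E mulrA mulr_sumr; congr (_ / _); apply: eq_bigr => i _.
by field; rewrite gt_eqF.
Qed.

(** * Functional calculus and traces in a fixed eigenbasis *)

Section EigenbasisOperators.
Variable R : realType.
Local Notation C := R[i].

Definition realdiag n (a : 'I_n -> R) : 'M[C]_n := diag_mx (\row_i (a i)%:C).

(** For unitary [U] the orthonormal eigenvectors are the rows of [U], which is the convention of
    [spectralmx]. *)
Definition eigenop n (U : 'M[C]_n) (a : 'I_n -> R) : 'M[C]_n :=
  U^t* *m realdiag a *m U.

Lemma unitarymxKl n (U : 'M[C]_n) : U \is unitarymx -> U^t* *m U = 1%:M.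
Proof. by move=> /unitarymxP/mulmx1C. Qed.

(* Independence of the functional calculus from the eigenbasis: a nonzero entry
   W i j of the change of basis forces d_j = a_i, hence f d_j = f a_i. *)
Lemma intertwine_map (f : R -> R) n (W : 'M[C]_n) (d : 'rV[C]_n)
    (a : 'I_n -> R) :
  W *m diag_mx d = realdiag a *m W ->
  W *m diag_mx (map_mx (fun z => (f (complex.Re z))%:C) d) =
  realdiag (f \o a) *m W.
Proof.
move=> /matrixP Wd; apply/matrixP => i j; have := Wd i j.
rewrite !mul_mx_diag !mul_diag_mx !mxE.
have [->|W0] := eqVneq (W i j) 0; first by rewrite !mul0r !mulr0.
by rewrite mulrC => /(mulIf W0) ->; rewrite mulrC.
Qed.

(** Both [U] and the spectral basis [P] diagonalize the matrix, so [U *m invmx P] intertwines the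
    two diagonals, and therefore also their images under [f]. *)
Lemma hermfun_eigenop (f : R -> R) n (U : 'M[C]_n) (a : 'I_n -> R) :
  U \is unitarymx -> hermfun f (eigenop U a) = eigenop U (f \o a).
Proof.
move=> Uu; set A := eigenop U a.
have UK := unitarymxKl Uu; have KU := unitarymxP Uu.
have An : A \is normalmx.
  apply/orthomx_spectral_subproof; exists (U, \row_i (a i)%:C) => //=.
  by rewrite invmx_unitary.
have /orthomx_spectralP := An; rewrite /hermfun.
set P := spectralmx A; set d := spectral_diag A => AE.
have Pu : P \in unitmx by exact: spectral_unit.
have /(intertwine_map f) comf :
    (U *m invmx P) *m diag_mx d = realdiag a *m (U *m invmx P).
  rewrite -[in LHS]mulmxA.
  have -> : invmx P *m diag_mx d = A *m invmx P by rewrite AE mulmxK.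
  by rewrite /A /eigenop !mulmxA KU mul1mx.
set df := map_mx _ d.
have -> : invmx P *m diag_mx df = U^t* *m (U *m invmx P *m diag_mx df).
  by rewrite !mulmxA UK mul1mx.
by rewrite comf !mulmxA mulmxKV.
Qed.

Lemma mul_realdiag n (a b : 'I_n -> R) :
  realdiag a *m realdiag b = realdiag (fun i => a i * b i).
Proof.
rewrite /realdiag mulmx_diag; congr diag_mx; apply/rowP => i.
by rewrite !mxE rmorphM.
Qed.

Lemma mul_eigenop n (U : 'M[C]_n) (a b : 'I_n -> R) : U \is unitarymx ->
  eigenop U a *m eigenop U b = eigenop U (fun i => a i * b i).
Proof.
move=> Uu; rewrite /eigenop -mul_realdiag -!mulmxA.
by rewrite (mulmxA U (U^t*)) (unitarymxP Uu) mul1mx.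
Qed.

Lemma scale_eigenop n (U : 'M[C]_n) (x : R) (a : 'I_n -> R) :
  x%:C *: eigenop U a = eigenop U (fun i => x * a i).
Proof.
rewrite /eigenop scalemxAl scalemxAr; suff -> : x%:C *: realdiag a =
  realdiag (fun i => x * a i) by [].
rewrite /realdiag -linearZ; congr diag_mx; apply/rowP => i.
by rewrite !mxE rmorphM.
Qed.

Lemma trace_eigenop n (U : 'M[C]_n) (a : 'I_n -> R) : U \is unitarymx ->
  \tr (eigenop U a) = (\sum_i a i)%:C.
Proof.
move=> Uu; rewrite /eigenop -mulmxA mxtrace_mulC -mulmxA (unitarymxP Uu) mulmx1.
by rewrite mxtrace_diag rmorph_sum; apply: eq_bigr => i _; rewrite mxE.
Qed.

Lemma eigenop_unit n (U : 'M[C]_n) (a : 'I_n -> R) : U \is unitarymx ->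
  (eigenop U a \in unitmx) = [forall i, a i != 0].
Proof.
move=> Uu; rewrite /eigenop !unitmx_mul [U \in _]unitarymx_unit// andbT.
rewrite unitarymx_unit ?trmxC_unitary//= unitmxE det_diag unitfE prodf_seq_neq0.
apply/allP/forallP => [h i|h i _]; last first.
  by rewrite mxE (inj_eq (@complexI _)) /= h.
by have := h i (mem_index_enum i); rewrite mxE (inj_eq (@complexI _)).
Qed.

Lemma invmx_eigenop n (U : 'M[C]_n) (a : 'I_n -> R) : U \is unitarymx ->
  (forall i, a i != 0) -> invmx (eigenop U a) = eigenop U (fun i => (a i)^-1).
Proof.
move=> Uu a0; have au : eigenop U a \in unitmx.
  by rewrite eigenop_unit//; apply/forallP.
apply: (can_inj (mulKmx au)); rewrite mulmxV// mul_eigenop//.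
rewrite -(unitarymxKl Uu) /eigenop.
have -> : realdiag (fun i => a i * (a i)^-1) = 1%:M.
  rewrite /realdiag -diag_const_mx; congr diag_mx; apply/rowP => i.
  by rewrite !mxE mulfV.
by rewrite mulmx1.
Qed.

(** All factors are diagonal in the one basis [U], so products, inverse and functional calculus act
    entrywise and the trace becomes a sum. *)
Lemma relative_quantifier_eigenop (F : R -> R) (x : R) n (U : 'M[C]_n)
    (r s : 'I_n -> R) : U \is unitarymx -> (forall i, s i != 0) ->
  relative_quantifier F x (eigenop U r) (eigenop U s) =
  (\sum_i r i * F (ln (x * (r i / s i))))%:C.
Proof.
move=> Uu s0; rewrite /relative_quantifier invmx_eigenop// mul_eigenop//.
by rewrite scale_eigenop !hermfun_eigenop// mul_eigenop// trace_eigenop.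
Qed.

(** * Simultaneous diagonalization of commuting Hermitian matrices *)

Lemma hermsym_conj n (A : 'M[C]_n) : A \is hermsymmx -> A^t* = A.
Proof. by move/is_hermitianmxP; rewrite expr0 scale1r => <-. Qed.

(* A + i B is normal; a spectral basis for it diagonalizes A and B, the real and
   imaginary parts of its spectrum being their eigenvalues. *)
Lemma commuting_hermsym_eigenop n (A B : 'M[C]_n) :
  A \is hermsymmx -> B \is hermsymmx -> comm_mx A B ->
  exists U a b, [/\ U \is unitarymx, A = eigenop U a & B = eigenop U b].
Proof.
move=> /hermsym_conj Ah /hermsym_conj Bh AB; pose N := A + ('i *: B)%R.
have NC : N^t* = A - ('i *: B)%R.
  by rewrite linearD linearZ/= map_mxD map_mxZ/= Ah Bh conjCi scaleNr.
have /orthomx_spectralP : N \is normalmx.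
  apply/normalmxP; rewrite NC /N; set X := _ *: B.
  have AX : A *m X = X *m A by rewrite -scalemxAr -scalemxAl AB.
  rewrite mulmxDl mulmxBl !mulmxDr !mulmxN AX !addrA subrK.
  by rewrite opprD addrA addrK.
set U := spectralmx N; set d := spectral_diag N.
have Uu : U \is unitarymx by exact: spectral_unitarymx.
rewrite invmx_unitary// => NE.
have NE' : N^t* = U^t* *m diag_mx (map_mx Num.conj d) *m U.
  rewrite {1}NE !trmx_mul !map_mxM trmxCK mulmxA.
  by rewrite tr_diag_mx map_diag_mx.
have half (X : 'M[C]_n) : 2^-1 *: (X + X) = X.
  by rewrite scalerDr -scalerDl -[2^-1]mul1r -splitr scale1r.
exists U, (fun i => complex.Re (d 0 i)), (fun i => complex.Im (d 0 i)); split => //.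
- have -> : A = 2^-1 *: (N + N^t*).
    by rewrite NC /N addrACA subrr addr0 half.
  rewrite NE' {1}NE -mulmxDl -mulmxDr scalemxAl scalemxAr -linearD -linearZ.
  rewrite /eigenop /realdiag; do 2 f_equal.
  by apply: f_equal; apply/rowP => i; rewrite !mxE complexRe ReE mulrC.
- have -> : B = 2^-1 *: ('i%R *: (N^t* - N)).
    rewrite NC /N opprD addrACA subrr add0r scalerDr scalerN scalerA.
    by rewrite -expr2 sqrCi scaleN1r opprK half.
  rewrite NE' {1}NE -mulmxBl -mulmxBr scalerA scalemxAl scalemxAr -linearB -linearZ.
  rewrite /eigenop /realdiag; do 2 f_equal.
  by apply: f_equal; apply/rowP => i; rewrite !mxE complexIm ImE [RHS]mulrC mulrA.
Qed.

(** * Positivity and quantum channels in eigenbases *)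

(* For k = 1 the size \sum_(i < 1) n is not convertible to n, whence the detour
   through one-block matrices to extract positivity from complete positivity. *)
Lemma single_block_form n (X : 'M[C]_n) (v : 'rV[C]_(\sum_(i < 1) n)) :
  v *m \mxblock_(i < 1, j < 1) X *m v^t* =
  submxrow v 0 *m X *m (submxrow v 0)^t*.
Proof.
rewrite -{1}(submxrowK v) mul_mxrow_mxblock -{2}(submxrowK v).
have -> : (\mxrow_j submxrow v j)^t* = \mxcol_j (submxrow v j)^t*.
  by apply/matrixP => i j; rewrite !mxE.
by rewrite mul_mxrow_mxcol !big_ord1.
Qed.

Lemma psd_single_block n (X : 'M[C]_n) :
  psd X <-> psd (\mxblock_(i < 1, j < 1) X).
Proof.
split=> -[Xh Xp]; split.
- apply/is_hermitianmxP; rewrite expr0 scale1r; apply/matrixP => i j.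
  by move/hermsym_conj/matrixP: Xh => Xh; rewrite !mxE -[in LHS]Xh !mxE.
- by move=> v; rewrite single_block_form.
- apply/is_hermitianmxP; rewrite expr0 scale1r.
  have XE : X = submxblock (\mxblock_(i < 1, j < 1) X) 0 0 by rewrite mxblockK.
  rewrite {1}XE -(hermsym_conj Xh) {2}XE; apply/matrixP => i j.
  by rewrite !mxE.
- move=> v; have := Xp (\mxrow_(j < 1) v).
  by rewrite single_block_form mxrowK.
Qed.

Lemma completely_positive_psd n (E : 'M[C]_n -> 'M[C]_n) (X : 'M[C]_n) :
  completely_positive E -> psd X -> psd (E X).
Proof.
move=> /(_ 1%N (\mxblock_(i < 1, j < 1) X)) EP /psd_single_block /EP.
suff -> : ampliation E (\mxblock_(i < 1, j < 1) X) = \mxblock_(i < 1, j < 1) E X.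
  by rewrite -psd_single_block.
by apply: eq_mxblock => i j; rewrite mxblockK.
Qed.

(** The diagonal entry is the quadratic form of [X] at [row i V]. *)
Lemma psd_diag_ge0 n (X V : 'M[C]_n) i : psd X -> 0 <= (V *m X *m V^t*) i i.
Proof.
move=> [_ /(_ (row i V))]; congr (0 <= _).
rewrite -row_mul [LHS]mxE [RHS]mxE; apply: eq_bigr => j _.
by rewrite [row i _ 0 j]mxE; congr (_ * _); rewrite !mxE.
Qed.

Lemma eigenop_conj n (U : 'M[C]_n) (a : 'I_n -> R) : U \is unitarymx ->
  U *m eigenop U a *m U^t* = realdiag a.
Proof.
move=> /unitarymxP UK; rewrite /eigenop !mulmxA UK mul1mx -mulmxA UK.
by rewrite mulmx1.
Qed.

Lemma psd_eigenopP n (U : 'M[C]_n) (a : 'I_n -> R) : U \is unitarymx ->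
  psd (eigenop U a) <-> forall i, 0 <= a i.
Proof.
move=> Uu; split=> [aP i|a0].
  have := psd_diag_ge0 U i aP; rewrite eigenop_conj// !mxE eqxx mulr1n.
  by rewrite -lecR.
split.
  apply/is_hermitianmxP; rewrite expr0 scale1r /eigenop !trmx_mul !map_mxM.
  rewrite trmxCK mulmxA /realdiag tr_diag_mx map_diag_mx.
  suff -> : map_mx Num.conj (\row_i (a i)%:C) = \row_i (a i)%:C by [].
  apply/rowP => i; rewrite !mxE; apply/CrealP.
  by rewrite complex_real.
(* In the coordinates [v *m U^t*] the form is a sum of squared moduli weighted by the [a i]. *)
move=> v; have -> : v *m eigenop U a *m v^t* =
    (v *m U^t*) *m realdiag a *m (v *m U^t*)^t*.
  by rewrite trmx_mul map_mxM trmxCK /eigenop !mulmxA.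
rewrite mxE sumr_ge0// => j _; rewrite mul_mx_diag !mxE.
rewrite mulrAC mulr_ge0 ?mul_conjC_ge0//.
by rewrite lecR.
Qed.

(** [T j i] is the probability of finding outcome [j] in the basis [V] after [E] acts on the [i]-th
    eigenprojector of [U]. Positivity of [E] gives nonnegative entries, trace preservation the
    column sums, and linearity the action on spectra. [T] is chosen before [a] and [b], so a single
    matrix serves several operators diagonal in [U]. *)
Lemma channel_stochastic n (E : {linear 'M[C]_n -> 'M[C]_n}) (U V : 'M[C]_n) :
  quantum_channel E -> U \is unitarymx -> V \is unitarymx ->
  exists T : 'I_n -> 'I_n -> R,
    [/\ forall j i, 0 <= T j i,
        forall i, \sum_j T j i = 1 &
        forall a b, E (eigenop U a) = eigenop V b ->
          forall j, b j = \sum_i T j i * a i].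
Proof.
move=> [Ecp Etr] Uu Vu.
(* The rank-one projector onto the [i]-th row of [U]. *)
pose B i := eigenop U (fun j => (j == i)%:R).
pose T j i := complex.Re ((V *m E (B i) *m V^t*) j j).
have Tge0 j i : 0 <= (V *m E (B i) *m V^t*) j j.
  apply: psd_diag_ge0; apply: completely_positive_psd => //.
  by apply/psd_eigenopP => // k; rewrite ler0n.
have TE j i : (T j i)%:C = (V *m E (B i) *m V^t*) j j.
  by rewrite RRe_real// ger0_real.
exists T; split.
- by move=> j i; have := Tge0 j i; rewrite -TE lecR.
- move=> i; apply: (@complexI R); rewrite rmorph_sum /=.
  under eq_bigr do rewrite TE.
  rewrite -/(mxtrace _) mxtrace_mulC mulmxA unitarymxKl// mul1mx Etr.
  rewrite trace_eigenop// (bigD1 i)//= eqxx big1 ?addr0// => j /negPf -> //.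
- move=> a b Eab j; apply: (@complexI R).
  have -> : (b j)%:C = (V *m eigenop V b *m V^t*) j j.
    by rewrite eigenop_conj// !mxE eqxx mulr1n.
  have -> : eigenop V b = \sum_i (a i)%:C *: E (B i).
    rewrite -Eab; under eq_bigr do rewrite -linearZ.
    rewrite -linear_sum; congr (E _).
    rewrite /B; under eq_bigr do rewrite scale_eigenop.
    rewrite /eigenop -mulmx_suml -mulmx_sumr; f_equal; f_equal.
    rewrite /realdiag -linear_sum; apply: f_equal; apply/rowP => k.
    rewrite summxE !mxE (bigD1 k)//= !mxE eqxx mulr1 big1 ?addr0// => l lk.
    by rewrite mxE eq_sym (negPf lk) mulr0.
  rewrite mulmx_sumr mulmx_suml summxE rmorph_sum; apply: eq_bigr => i _.
  by rewrite -scalemxAr -scalemxAl mxE rmorphM /= TE mulrC.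
Qed.

(** Eigenvectors are row vectors here. The coordinates [v *m U^t*] of an eigenvector have a nonzero
    entry, and comparing there identifies [z]; conversely [row i U] is an eigenvector for [a i]. *)
Lemma eigenvalue_eigenop n (U : 'M[C]_n) (a : 'I_n -> R) (z : C) :
  U \is unitarymx -> eigenvalue (eigenop U a) z <-> exists i, z = (a i)%:C.
Proof.
move=> Uu; split=> [/eigenvalueP[v vz v0]|[i ->]].
  have : (v *m U^t*) *m realdiag a = z *: (v *m U^t*).
    by rewrite scalemxAl -vz /eigenop !mulmxA mulmxtVK.
  have : v *m U^t* != 0.
    apply: contraNneq v0 => v0.
    by rewrite -(mulmx1 v) -(unitarymxKl Uu) mulmxA v0 mul0mx.
  move=> /rV0Pn[i wi] /rowP/(_ i); rewrite mul_mx_diag !mxE mulrC.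
  move=> h; exists i; apply/esym/(mulIf wi); move: h; rewrite !mxE; exact.
apply/eigenvalueP; exists (row i U).
  rewrite -row_mul /eigenop !mulmxA (unitarymxP Uu) mul1mx.
  by apply/rowP => j; rewrite mul_diag_mx !mxE.
apply/eqP => /(congr1 (mulmx^~ (U^t*))).
rewrite /= -row_mul (unitarymxP Uu) mul0mx => /rowP/(_ i)/eqP.
by rewrite !mxE eqxx oner_eq0.
Qed.

End EigenbasisOperators.

(** * Commuting pairs of states and the monotonicity theorem *)

(** The bound [r i <= 1] comes from nonnegative eigenvalues with sum 1; [0 < s i] comes from
    nonnegativity together with invertibility. *)
Lemma commuting_densities_eigenop (R : realType) n (rho sigma : 'M[R[i]]_n) :
  density rho -> density sigma -> comm_mx rho sigma -> sigma \in unitmx ->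
  exists U r s, [/\ U \is unitarymx, rho = eigenop U r, sigma = eigenop U s,
    forall i, 0 <= r i <= 1 & forall i, 0 < s i].
Proof.
move=> [rho_psd rho_tr] [sigma_psd _] comm sigma_unit.
have [U [r [s [Uu rhoE sigmaE]]]] :=
  commuting_hermsym_eigenop rho_psd.1 sigma_psd.1 comm.
subst rho sigma; exists U, r, s; split=> //.
- have /(psd_eigenopP _ Uu) r0 := rho_psd.
  move: rho_tr; rewrite trace_eigenop// => /(@complexI R) r1 i.
  rewrite r0 -r1 (bigD1 i)//= lerDl.
  by apply: sumr_ge0 => j _.
- have /(psd_eigenopP _ Uu) s0 := sigma_psd.
  move: sigma_unit; rewrite eigenop_unit// => /forallP s_neq0 i.
  by rewrite lt_def s_neq0 s0.
Qed.

Theorem theorem2 (R : realType) (F : R -> R)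
    (F_smooth : smooth F)
    (F_concave : concave_on `[0, 1] (fun x : R => x * F (ln x)))
    (n : nat) (rho sigma rho' sigma' : 'M[R[i]]_n)
    (rho_state : density rho) (sigma_state : density sigma)
    (rho'_state : density rho') (sigma'_state : density sigma')
    (comm : comm_mx rho sigma) (comm' : comm_mx rho' sigma')
    (sigma_full : sigma \in unitmx) (sigma'_full : sigma' \in unitmx)
    (maj : pair_majorizes rho sigma rho' sigma')
    (smin : R) (smin_min : smallest_eigenvalue sigma smin) :
  relative_quantifier F smin rho sigma <= relative_quantifier F smin rho' sigma'.
Proof.
have [U [r [s [Uu rhoE sigmaE r01 s0]]]] :=
  commuting_densities_eigenop rho_state sigma_state comm sigma_full.
have [V [r' [s' [Vu rho'E sigma'E _ s'0]]]] :=
  commuting_densities_eigenop rho'_state sigma'_state comm' sigma'_full.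
have [E [Ech Erho Esigma]] := maj.
(* Because one channel sends both states and each pair shares a basis, the same [T] maps [r] to [r']
   and [s] to [s']. *)
have [T [T0 T1 TE]] := channel_stochastic Ech Uu Vu.
have [smin_eig smin_le] := smin_min.
(* Being some [s k] makes [smin] positive; being the least eigenvalue bounds every [s i] from
   below. *)
have [k /(@complexI R) sminE] : exists k, smin%:C = (s k)%:C.
  by apply/(eigenvalue_eigenop _ _ Uu); rewrite -sigmaE.
have ms i : smin <= s i.
  rewrite -lecR; apply: smin_le; rewrite sigmaE.
  by apply/(eigenvalue_eigenop _ _ Uu); exists i.
rewrite rhoE sigmaE rho'E sigma'E !relative_quantifier_eigenop//; last first.
- by move=> i; rewrite gt_eqF.
- by move=> i; rewrite gt_eqF.
rewrite lecR; apply: (stochastic_relative_quantifier F_concave T0 T1) => //.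
- by apply: TE; rewrite -rhoE -rho'E.
- by apply: TE; rewrite -sigmaE -sigma'E.
- by rewrite sminE.
Qed.
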